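(* For any cycle $C_n$ of order $n \geq 3$, $$\tilde{\gamma}_{c}(M(C_n)) = n-1.$$
   Context: All graphs are non-empty, finite, undirected and simple. The order of a graph is its number of vertices. A dominating set of a graph $H$ is a set $S \subseteq V(H)$ such that $N_H[v] \cap S \neq \emptyset$ for every $v \in V(H)$, where $N_H[v]$ is the closed neighborhood of $v$. A dominating set $S$ of $H$ is an outer-connected dominating set if the graph $H - S$ (obtained by deleting the vertices in $S$) is connected. The outer-connected domination number $\tilde{\gamma}_c(H)$ is the minimum cardinality of an outer-connected dominating set of $H$. The middle graph $M(G)$ of a graph $G$ is the graph with vertex set $V(G) \cup E(G)$ (disjoint union), in which two vertices $x,y$ are adjacent if and only if either $x,y \in E(G)$ are distinct edges sharing an endpoint in $G$, or one of them is a vertex of $G$ and the other is an edge of $G$ incident with it. *)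

(* Defs.v *)
From mathcomp Require Import all_boot.

Set Implicit Arguments.
Unset Strict Implicit.
Unset Printing Implicit Defensive.

Record sgraph := SGraph {
  vertex :> finType;
  adj : rel vertex;
  adj_sym : symmetric adj;
  adj_irrefl : irreflexive adj }.

Definition isomorphic (G H : sgraph) : Prop :=
  exists2 f : G -> H, bijective f & forall x y : G, adj (f x) (f y) = adj x y.

(* Graphs are non-empty by convention, so the graph without vertices does not
   count as connected. *)
Definition connected_graph (G : sgraph) : bool :=
  (0 < #|G|) && [forall x : G, forall y : G, connect (@adj G) x y].

Section DeleteVertices.
Variables (G : sgraph) (S : {set G}).

Definition delete_adj : rel {x : G | x \notin S} :=
  fun x y => adj (val x) (val y).

Lemma delete_adj_sym : symmetric delete_adj.
Proof. by move=> x y; apply: adj_sym. Qed.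

Lemma delete_adj_irrefl : irreflexive delete_adj.
Proof. by move=> x; apply: adj_irrefl. Qed.

Definition delete_vertices : sgraph := SGraph delete_adj_sym delete_adj_irrefl.
End DeleteVertices.

Section Domination.
Variable H : sgraph.

Definition closed_neighborhood (v : H) : {set H} :=
  [set u | (u == v) || adj v u].

Definition dominating (S : {set H}) : bool :=
  [forall v : H, closed_neighborhood v :&: S != set0].

Definition outer_connected_dominating (S : {set H}) : bool :=
  dominating S && connected_graph (delete_vertices S).

(* The default [set: H] is used only if no outer-connected dominating set
   exists.  This happens only for edgeless H: if v is not isolated, then
   [set~ v] is outer-connected dominating. *)
Definition outer_connected_domination_number : nat :=
  #|[arg min_(S < [set: H] | outer_connected_dominating S) #|S|]|.
End Domination.

Section MiddleGraph.
Variable G : sgraph.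

Definition edges : {set {set G}} :=
  [set e | [exists x : G, exists y : G, adj x y && (e == [set x; y])]].

Definition edge : finType := {e : {set G} | e \in edges}.

Definition middle_adj : rel (G + edge)%type := fun a b =>
  match a, b with
  | inl _, inl _ => false
  | inl x, inr e | inr e, inl x => x \in val e
  | inr e, inr f => (e != f) && (val e :&: val f != set0)
  end.

Lemma middle_adj_sym : symmetric middle_adj.
Proof. by move=> [x|e] [y|f] //=; rewrite eq_sym setIC. Qed.

Lemma middle_adj_irrefl : irreflexive middle_adj.
Proof. by move=> [x|e] //=; rewrite eqxx. Qed.

Definition middle_graph : sgraph := SGraph middle_adj_sym middle_adj_irrefl.
End MiddleGraph.

Section CycleGraph.
Variable n : nat.

(* ordS is the successor modulo n.  The condition i != j matters only for
   n = 1, where ordS is the identity. *)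
Definition cycle_adj : rel 'I_n :=
  fun i j => (i != j) && ((j == ordS i) || (i == ordS j)).

Lemma cycle_adj_sym : symmetric cycle_adj.
Proof. by move=> i j; rewrite /cycle_adj eq_sym orbC. Qed.

Lemma cycle_adj_irrefl : irreflexive cycle_adj.
Proof. by move=> i; rewrite /cycle_adj eqxx. Qed.

Definition cycle_graph : sgraph := SGraph cycle_adj_sym cycle_adj_irrefl.
End CycleGraph.

(* Main.v *)
Require Import Defs.
From mathcomp Require Import all_boot zify.

(** The middle graph of C_n is a cyclic ring of triangles: the edges m_0, ...,
    m_{n-1} of C_n form a cycle, and the vertex v_{i+1} is a tip attached to the
    two consecutive hubs m_i and m_{i+1} ([middle_cycle_isomorphic]).

    Upper bound ([opened_ring_ocd]): deleting m_0 and all tips except the two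
    adjacent to m_0 leaves a path, and this deleted set, of cardinality
    1 + (n - 2), is dominating.

    Lower bound ([ring_ocd_card_ge]): let S be outer-connected dominating.  If a
    tip outside S has both of its hubs in S, it is isolated in the complement,
    which is then a single vertex, and S has 2n - 1 elements.  Otherwise, as S
    dominates each tip outside S, such a tip has exactly one of its two hubs in
    S: it sits at an end of a maximal arc of consecutive hubs outside S.  Two
    such arcs would lie in different components of the complement of S
    ([one_arc_of_remaining_hubs]), so there is at most one arc and at most two
    tips lie outside S; if some tip does, then some hub is in S.  In every case
    at most n + 1 of the 2n vertices lie outside S. *)

Set Implicit Arguments.
Unset Strict Implicit.
Unset Printing Implicit Defensive.

(** * Connectedness after deletion, and isomorphism invariance *)

(** Expressing connectedness through cuts avoids the subtype on which
    [delete_vertices] is built. *)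
Lemma connected_deleteP (G : sgraph) (S : {set G}) :
  connected_graph (delete_vertices S) <->
  (exists x, x \notin S) /\
  (forall A : {set G},
     (forall x y, x \notin S -> y \notin S -> adj x y -> x \in A -> y \in A) ->
     forall x y, x \notin S -> y \notin S -> x \in A -> y \in A).
Proof.
split=> [/andP[/card_gt0P[x0 _] conn]|[[x0 x0S] cut]].
  split=> [|A clA x y xS yS xA]; first by exists (val x0); exact: (valP x0).
  have symD : connect_sym (@adj (delete_vertices S)).
    exact/sym_connect_sym/adj_sym.
  have clD : closed (@adj (delete_vertices S))
                    [pred z : delete_vertices S | val z \in A].
    apply: (intro_closed symD) => u v uv uA.
    exact: clA (val u) (val v) (valP u) (valP v) uv uA.
  have /forallP/(_ (Sub x xS))/forallP/(_ (Sub y yS)) xy := conn.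
  by have := closed_connect clD xy; rewrite !inE /= xA => <-.
apply/andP; split; first by apply/card_gt0P; exists (Sub x0 x0S).
apply/forallP=> x; apply/forallP=> y.
pose A := [set val z | z : delete_vertices S in connect (@adj _) x].
have xA : val x \in A by apply/imsetP; exists x => //; exact: connect0.
have clA u v : u \notin S -> v \notin S -> adj u v -> u \in A -> v \in A.
  move=> uS vS uv /imsetP[z xz uz]; apply/imsetP; exists (Sub v vS) => //.
  apply: connect_trans xz (connect1 _).
  by rewrite /= /delete_adj /= -uz.
have /imsetP[z xz /val_inj ->] := cut A clA _ _ (valP x) (valP y) xA.
exact: xz.
Qed.

Lemma outer_connected_dominating_imset (G H : sgraph) (f : G -> H) S :
    bijective f -> (forall x y, adj (f x) (f y) = adj x y) ->
  outer_connected_dominating S -> outer_connected_dominating (f @: S).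
Proof.
move=> [g fK gK] f_adj /andP[/forallP dom /connected_deleteP[[x0 x0S] cut]].
have f_inj : injective f := can_inj fK.
have inS x : (f x \in f @: S) = (x \in S) by rewrite mem_imset.
apply/andP; split.
  apply/forallP=> w; have /set0Pn[u] := dom (g w).
  rewrite !inE => /andP[uw uS]; apply/set0Pn; exists (f u).
  by rewrite !inE inS uS andbT -(gK w) (inj_eq f_inj) f_adj.
apply/connected_deleteP; split=> [|A clA x y].
  by exists (f x0); rewrite inS.
rewrite -(gK x) -(gK y) !inS => xS yS xA.
have clA' u v : u \notin S -> v \notin S -> adj u v ->
    u \in f @^-1: A -> v \in f @^-1: A.
  by rewrite !inE => uS vS uv; apply: clA; rewrite ?inS ?f_adj.
have := cut _ clA' _ _ xS yS; rewrite !inE; exact.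
Qed.

(** The default value [set: H] of the minimum leaves nothing connected, so
    [arg_minnP] does not apply as it stands; the witness [S] shows that the
    default is not taken. *)
Lemma outer_connected_domination_number_eq (H : sgraph) (S : {set H}) :
    outer_connected_dominating S ->
    (forall T : {set H}, outer_connected_dominating T -> #|S| <= #|T|) ->
  outer_connected_domination_number H = #|S|.
Proof.
move=> ocdS minS; rewrite /outer_connected_domination_number /arg_min /extremum.
case: pickP => [T /andP[ocdT /forall_inP minT]|/(_ S)] /=.
  by apply/eqP; rewrite eqn_leq minT ?minS.
by rewrite ocdS /= => /negbT/forall_inPn[T ocdT]; rewrite minS.
Qed.

(** * The middle graph of a cycle is a ring of triangles *)

#[local] Arguments ordS : simpl never.
#[local] Arguments ord_pred : simpl never.

Lemma ord_eqE n (i j : 'I_n) : (i == j) = (i == j :> nat).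
Proof. by []. Qed.

Section TriangleRing.
Variable n : nat.

Definition ring_adj : rel ('I_n + 'I_n)%type := fun a b =>
  match a, b with
  | inl _, inl _ => false
  | inl i, inr j | inr j, inl i => (i == j) || (i == ordS j)
  | inr i, inr j => cycle_adj i j
  end.

Lemma ring_adj_sym : symmetric ring_adj.
Proof. by move=> [i|i] [j|j] //=; apply: cycle_adj_sym. Qed.

Lemma ring_adj_irrefl : irreflexive ring_adj.
Proof. by move=> [i|i] //=; apply: cycle_adj_irrefl. Qed.

(** [inr j] is the hub m_j, standing for the edge {j, j+1} of the cycle, and
    [inl i] is the tip v_i. *)
Definition triangle_ring : sgraph := SGraph ring_adj_sym ring_adj_irrefl.

Lemma ordS_cases (i : 'I_n) :
  i.+1 < n /\ ordS i = i.+1 :> nat \/ i.+1 = n /\ ordS i = 0 :> nat.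
Proof.
rewrite /ordS /=; have := ltn_ord i; rewrite leq_eqVlt => /orP[/eqP i_n|lt_in].
  by right; rewrite i_n modnn.
by left; rewrite modn_small.
Qed.

End TriangleRing.

Lemma cycle_adj_ordS n (i : 'I_n) : 1 < n -> cycle_adj i (ordS i).
Proof.
move=> n_gt1.
by rewrite /cycle_adj eqxx andbT ord_eqE; have := ordS_cases i; lia.
Qed.

(** For [n = 2] both arcs would join the same two vertices. *)
Lemma cycle_arc_inj n (i j : 'I_n) :
  2 < n -> [set i; ordS i] = [set j; ordS j] -> i = j.
Proof.
move=> n_gt2 /setP eq_arc.
have := eq_arc i; have := eq_arc (ordS i); rewrite !inE !eqxx orbT /=.
rewrite !ord_eqE => *; apply: val_inj => /=.
by have := ordS_cases i; have := ordS_cases j; lia.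
Qed.

(** Since [n > 2], each edge of the cycle is {i, i+1} for exactly one [i], which
    then indexes the corresponding hub. *)
Lemma middle_cycle_isomorphic n (C : sgraph) :
    2 < n -> isomorphic C (cycle_graph n) ->
  isomorphic (triangle_ring n) (middle_graph C).
Proof.
move=> n_gt2 [f [g fK gK] f_adj].
have g_inj : injective g := can_inj gK.
have g_adj i j : adj (g i) (g j) = @cycle_adj n i j by rewrite -f_adj !gK.
have arcP (i : 'I_n) : [set g i; g (ordS i)] \in edges C.
  rewrite inE; apply/existsP; exists (g i); apply/existsP; exists (g (ordS i)).
  by rewrite g_adj cycle_adj_ordS ?eqxx // ltnW.
pose arc i : edge C := exist (fun e => e \in edges C) _ (arcP i).
have in_arc x i : (x \in val (arc i)) = (f x == i) || (f x == ordS i).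
  by rewrite /= !inE -!(can_eq fK) !gK.
have arc_inj : injective arc.
  move=> i j /(congr1 val) /= /setP eq_arc; apply: cycle_arc_inj n_gt2 _.
  by apply/setP=> k; have := eq_arc (g k); rewrite !inE !(inj_eq g_inj).
have arc_surj (e : edge C) : exists i, e = arc i.
  case: e => e eE; have := eE.
  rewrite inE => /existsP[x /existsP[y /andP[xy /eqP e_xy]]].
  move: xy; rewrite -f_adj => /andP[_ /orP[] /eqP eq_f].
    exists (f x); apply: val_inj; rewrite /= fK -eq_f fK; exact: e_xy.
  by exists (f y); apply: val_inj; rewrite /= fK -eq_f fK setUC; exact: e_xy.
pose h (a : triangle_ring n) : middle_graph C :=
  match a with inl i => inl (g i) | inr i => inr (arc i) end.
exists h.
  have h_inj : injective h.
    move=> [i|i] [j|j] // [eq_ij]; first by rewrite (g_inj _ _ eq_ij).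
    by congr inr; apply/arc_inj/val_inj.
  apply: (inj_card_bij h_inj); rewrite -(card_codom h_inj).
  apply/subset_leq_card/subsetP=> -[x|e] _.
    by apply/codomP; exists (inl (f x)); rewrite /= fK.
  by have [i ->] := arc_surj e; apply/codomP; exists (inr i).
have meet i j : (arc i != arc j) && (val (arc i) :&: val (arc j) != set0)
    = cycle_adj i j.
  rewrite (inj_eq arc_inj) /cycle_adj.
  apply/andP/andP=> -[ij]; split=> //.
    have /set0Pn[x] : val (arc i) :&: val (arc j) != set0 by [].
    rewrite in_setI !in_arc => /andP[/orP[]/eqP-> /orP[]].
    - by move=> eq_ij; rewrite eq_ij in ij.
    - by move=> ->; rewrite orbT.
    - by rewrite eq_sym => ->.
    - by rewrite (inj_eq (@ordS_inj n)) (negbTE ij).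
  apply/set0Pn; case/orP: b => /eqP eq_ij.
    by exists (g j); rewrite in_setI !in_arc gK eqxx eq_ij eqxx orbT.
  by exists (g i); rewrite in_setI !in_arc gK eqxx eq_ij eqxx orbT.
move=> [i|i] [j|j] //; last exact: meet.
  by rewrite -[LHS]/(g i \in val (arc j)) in_arc gK.
by rewrite -[LHS]/(g j \in val (arc i)) in_arc gK.
Qed.

(** * The upper bound *)

(** The complement is the path v_1, m_1, ..., m_{n-1}, v_0 whose two ends are
    dominated by m_0. *)
Definition opened_ring n : {set triangle_ring n} :=
  [set a : triangle_ring n |
    match a with inl i => 1 < i | inr i => i == 0 :> nat end].

Lemma card_set_sum (I J : finType) (A : {set I + J}) :
  #|A| = #|[set i | inl i \in A]| + #|[set j | inr j \in A]|.
Proof.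
rewrite -sum1_card big_sumType -!sum1_card.
by congr (_ + _); apply: eq_bigl => i; rewrite inE.
Qed.

Lemma card_opened_ring n : 1 < n -> #|opened_ring n| = n - 1.
Proof.
case: n => [|[|n]] // _; rewrite card_set_sum.
have -> : [set i | inl i \in opened_ring n.+2] = ~: [set ord0; inord 1].
  apply/setP=> i; rewrite !inE !ord_eqE /= inordK //.
  by case: (val i) => [|[]].
have -> : [set i | inr i \in opened_ring n.+2] = [set ord0].
  by apply/setP=> i; rewrite !inE.
have := cardsC [set ord0; inord 1 : 'I_n.+2].
by rewrite cards2 cards1 card_ord ord_eqE /= inordK //=; lia.
Qed.

Lemma opened_ring_ocd n : 2 < n -> outer_connected_dominating (opened_ring n).
Proof.
case: n => [|[|[|n]]] // _; set S := opened_ring n.+3.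
have hub0 : inr ord0 \in S by rewrite inE.
have next0 : ordS (ord0 : 'I_n.+3) = 1 :> nat by [].
apply/andP; split.
  apply/forallP=> a; apply/set0Pn.
  have [aS|aS] := boolP (a \in S); first by exists a; rewrite in_setI aS inE eqxx.
  case: a aS => i; rewrite inE => aS.
    exists (inr ord0); rewrite in_setI hub0 andbT inE /= !ord_eqE.
    by rewrite next0 /=; lia.
  have [i1|i1] := eqVneq (val i) 1.
    exists (inr ord0); rewrite in_setI hub0 andbT inE /=.
    rewrite /cycle_adj !ord_eqE.
    by rewrite next0 /=; move: i1 => /=; lia.
  exists (inl i); rewrite in_setI !inE /= eqxx.
  by move: aS i1 => /=; case: (val i) => [|[]].
apply/connected_deleteP; split; first by exists (inl ord0); rewrite inE.
(* every remaining vertex can reach the hub m_1 along m_{n-1}, ..., m_2, m_1 *)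
have toward (A : {set triangle_ring n.+3}) :
    (forall x y, x \notin S -> y \notin S -> adj x y -> x \in A -> y \in A) ->
    forall x, x \notin S -> x \in A -> inr (inord 1) \in A.
  move=> clA.
  have hub1 k : 0 < k < n.+3 -> inr (inord k) \in A -> inr (inord 1) \in A.
    elim: k => // -[|k] IHk kN kA //; apply: IHk; first lia.
    apply: clA kA; rewrite ?inE ?inordK //=; try lia.
    have := ordS_cases (inord k.+1 : 'I_n.+3).
    by rewrite /cycle_adj !ord_eqE !inordK; lia.
  move=> [] i; rewrite inE => iS iA.
    have [i0|i0] := eqVneq (val i) 0.
      apply: (hub1 n.+2); first by lia.
      apply: clA iA; rewrite ?inE ?inordK //= !ord_eqE.
      by have := ordS_cases (inord n.+2 : 'I_n.+3); rewrite inordK //= in i0 *; lia.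
    apply: clA iA; rewrite ?inE ?inordK //= !ord_eqE inordK //.
    by move: i0 iS => /=; lia.
  by apply: (hub1 i); rewrite ?inord_val // ltn_ord andbT lt0n.
move=> A clA x y xS yS xA; apply: contraT => yA.
(* the complement of A is closed as well, so it would also contain m_1 *)
have := toward A clA x xS xA; apply: contraLR => _.
rewrite -in_setC; apply: (toward (~: A) _ y yS); last by rewrite inE.
move=> u v uS vS uv; rewrite !inE; apply: contra; apply: clA => //.
by rewrite adj_sym.
Qed.

(** * The lower bound *)

Section LowerBound.
Variables (n : nat) (S : {set triangle_ring n}).
Hypothesis ocdS : outer_connected_dominating S.

Let cut (A : {set triangle_ring n}) :
  (forall x y, x \notin S -> y \notin S -> adj x y -> x \in A -> y \in A) ->
  forall x y, x \notin S -> y \notin S -> x \in A -> y \in A.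
Proof. by have /andP[_ /connected_deleteP[_ cutS]] := ocdS; apply: cutS. Qed.

Definition remaining_tips : {set 'I_n} := [set i | inl i \notin S].
Definition remaining_hubs : {set 'I_n} := [set i | inr i \notin S].

Lemma card_remaining : #|S| + (#|remaining_tips| + #|remaining_hubs|) = n + n.
Proof.
have -> : #|remaining_tips| + #|remaining_hubs| = #|~: S|.
  rewrite card_set_sum; congr (_ + _); apply: eq_card => i; rewrite !inE //.
by rewrite cardsC card_sum card_ord.
Qed.

(** The set on the left consists of the hubs in S that directly follow an arc
    of remaining hubs.  Two such hubs m_i and m_j, with i < j, would cut the
    ring between the arc ending at m_{j-1} and the one ending at m_{i-1}. *)
Lemma one_arc_of_remaining_hubs :
  #|(@ordS n @: remaining_hubs) :\: remaining_hubs| <= 1.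
Proof.
have cut_ends (i j : 'I_n) : i < j ->
    inr i \in S -> inr j \in S ->
    inr (ord_pred i) \notin S -> inr (ord_pred j) \notin S -> False.
  move=> ij iS jS pi pj.
  pose A : {set triangle_ring n} := [set a : triangle_ring n |
    match a with inl t => i < t <= j | inr t => i <= t < j end].
  have vi := ordS_cases (ord_pred i); have vj := ordS_cases (ord_pred j).
  rewrite !ord_predK in vi vj.
  have /cut/(_ _ _ pj pi) : forall x y,
      x \notin S -> y \notin S -> adj x y -> x \in A -> y \in A.
    have neS (t u : 'I_n) : inr u \in S -> inr t \notin S -> t <> u :> nat.
      by move=> uS tS /val_inj tu; rewrite tu uS in tS.
    move=> [] t [] u xS yS //=; rewrite /cycle_adj !ord_eqE !inE.
    - by have := neS _ _ iS yS; have := neS _ _ jS yS; have := ordS_cases u; lia.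
    - by have := neS _ _ iS xS; have := neS _ _ jS xS; have := ordS_cases t; lia.
    - have := neS _ _ iS yS; have := neS _ _ jS yS; have := ordS_cases u.
      by have := neS _ _ iS xS; have := neS _ _ jS xS; have := ordS_cases t; lia.
  by rewrite !inE; have := ltn_ord j; lia.
have endP i : i \in (@ordS n @: remaining_hubs) :\: remaining_hubs ->
    inr i \in S /\ inr (ord_pred i) \notin S.
  rewrite !inE negbK => /andP[iS /imsetP[k kT i_k]]; split=> //.
  by rewrite i_k ordSK; rewrite inE in kT.
apply/card_le1_eqP=> i j /endP[iS pi] /endP[jS pj]; apply: val_inj.
case: (ltngtP i j) => // ij; exfalso.
  exact: (cut_ends i j).
exact: (cut_ends j i).
Qed.

(** An isolated vertex in a connected complement is the whole complement. *)
Lemma isolated_tip_card_ge (i : 'I_n) :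
    inl i \notin S -> inr i \in S -> inr (ord_pred i) \in S ->
  #|remaining_tips| + #|remaining_hubs| <= 1.
Proof.
move=> tip hub hub'.
have only_i y : y \notin S -> y \in [set (inl i : triangle_ring n)].
  move=> yS; apply: (cut _ tip yS); rewrite ?inE // => u v _ vS uv.
  rewrite !inE => /eqP u_i; move: uv; rewrite u_i; case: v vS => //= j jS.
  case/orP=> /eqP i_j; first by rewrite -i_j hub in jS.
  by move: hub'; rewrite i_j ordSK (negbTE jS).
have -> : remaining_hubs = set0.
  by apply/setP=> j; rewrite !inE; apply/negP=> /negP jS; have := only_i _ jS; rewrite inE.
rewrite cards0 addn0; apply/card_le1_eqP=> j k; rewrite !inE.
by move=> jS kS; have /set1P[->] := only_i _ jS; have /set1P[->] := only_i _ kS.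
Qed.

Lemma ring_ocd_card_ge : n - 1 <= #|S|.
Proof.
have [/existsP[i /and3P[tip hub hub']]|/existsPn no_iso] :=
    boolP [exists i, [&& inl i \notin S, inr i \in S & inr (ord_pred i) \in S]].
  by have := isolated_tip_card_ge tip hub hub'; have := card_remaining; lia.
set P := remaining_tips; set T := remaining_hubs.
set T' : {set 'I_n} := @ordS n @: T.
have inT' i : (i \in T') = (ord_pred i \in T).
  by rewrite -{1}(ord_predK i) mem_imset //; exact: ordS_inj.
have cardT' : #|T'| = #|T| by apply: card_imset; exact: ordS_inj.
have tip_hub i : i \in P -> ~~ ((i \in T) && (i \in T')).
  rewrite inT' !inE => iP; have /andP[/forallP/(_ (inl i))/set0Pn[u]] := ocdS.
  rewrite !inE => /andP[/orP[/eqP->|]]; first by rewrite (negbTE iP).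
  case: u => //= j; case/orP=> /eqP-> jS _; rewrite ?ordSK jS //=.
  by rewrite andbF.
have sub : P \subset (T :\: T') :|: (T' :\: T).
  apply/subsetP=> i iP; have := no_iso i; have := tip_hub i iP.
  by move: iP; rewrite !in_setU !in_setD inT' !inE => ->; do 2!case: (_ \in S).
(* T and its shift T' have the same size, so as many arcs begin as end *)
have same_ends : #|T :\: T'| = #|T' :\: T|.
  by apply/eqP; rewrite -(eqn_add2l #|T :&: T'|) cardsID setIC cardsID cardT'.
have cardP : #|P| <= 2.
  apply: leq_trans (subset_leq_card sub) (leq_trans (leq_card_setU _ _) _).
  by rewrite same_ends -[2]/(1 + 1) leq_add // one_arc_of_remaining_hubs.
have := card_remaining; rewrite -/P -/T.
have := max_card T; rewrite card_ord => Tn.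
have [->|[i iP]] := set_0Vmem P; first by rewrite cards0; lia.
have T_lt : #|T| < n.
  rewrite ltn_neqAle Tn andbT; apply: contraNneq (tip_hub i iP) => cardT.
  have/eqP TT : T == setT by rewrite eqEcard subsetT cardsT card_ord cardT leqnn.
  by rewrite inT' TT !inE.
lia.
Qed.

End LowerBound.

Theorem theorem4p10 (n : nat) (C : sgraph) (n_ge3 : 3 <= n)
    (C_cycle : isomorphic C (cycle_graph n)) :
  outer_connected_domination_number (middle_graph C) = n - 1.
Proof.
have [h h_bij h_adj] := middle_cycle_isomorphic n_ge3 C_cycle.
have h_inj := bij_inj h_bij.
have card_ring : #|h @: opened_ring n| = n - 1.
  by rewrite card_imset // card_opened_ring // ltnW.
rewrite -card_ring; apply: outer_connected_domination_number_eq.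
  exact: outer_connected_dominating_imset h_bij h_adj (opened_ring_ocd n_ge3).
move=> T ocdT; rewrite card_ring.
have [k hK kK] := h_bij.
have k_adj x y : adj (k x) (k y) = adj x y by rewrite -h_adj !kK.
have k_bij : bijective k by exists h.
rewrite -(card_imset (mem T) (bij_inj k_bij)).
exact/ring_ocd_card_ge/(outer_connected_dominating_imset k_bij k_adj).
Qed.
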